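(* For each positive integer $n$, there are infinitely many finite transitive imprimitive permutation groups $G$ such that the Saxl graph $\Sigma(G)$ is connected and has diameter $n$.
   Context: A base for a permutation group $G\leqslant \mathrm{Sym}(\Omega)$ is a subset of $\Omega$ whose pointwise stabiliser in $G$ is trivial. The Saxl graph $\Sigma(G)$ has vertex set $\Omega$, with two (distinct) vertices adjacent if and only if they form a base for $G$. *)

(* Defs.v *)
From HB Require Import structures.
From mathcomp Require Import all_boot all_fingroup all_solvable.

Set Implicit Arguments.
Unset Strict Implicit.
Unset Printing Implicit Defensive.

Import GroupScope.

Section FiniteGraph.

Variables (T : finType) (e : rel T).

Definition graph_connected : bool := [forall x, forall y, connect e x y].

Definition has_walk (x y : T) (d : nat) : bool :=
  [exists p : d.-tuple T, path e x p && (last x p == y)].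

(* The least length of a walk from x to y. A shortest walk has no repeated    *)
(* vertex, hence length less than #|T|; the value is #|T| when y is not       *)
(* reachable from x.                                                          *)
Definition graph_dist (x y : T) : nat :=
  find (has_walk x y) (iota 0 #|T|).

Definition graph_diameter : nat := \max_(x : T) \max_(y : T) graph_dist x y.

End FiniteGraph.

Section PermutationGroup.

Variables (T : finType) (G : {group {perm T}}).

Definition is_base (B : {set T}) : bool := 'C_G(B | 'P) == 1.

Definition saxl_graph : rel T :=
  [rel x y | (x != y) && is_base [set x; y]].

Definition transitive_group : bool := [transitive G, on [set: T] | 'P].

Definition imprimitive_group : bool :=
  transitive_group && ~~ [primitive G, on [set: T] | 'P].

End PermutationGroup.

Definition perm_isomorphic (T U : finType)
    (G : {group {perm T}}) (H : {group {perm U}}) : Prop :=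
  exists (f : T -> U) (phi : {morphism G >-> {perm U}}),
    [/\ bijective f, isom G H phi &
        forall (x : T) (g : {perm T}), g \in G -> f (g x) = phi g (f x)].

(* Main.v *)
(* For n = 1, regular groups have a complete Saxl graph. For n > 1, take a    *)
(* Cayley graph on an abelian group V of diameter n (here the cycle of length *)
(* 2n), a nontrivial abelian group A, and let K be the product of copies of A *)
(* indexed by the pairs {i, j} of non-adjacent vertices (i = j allowed). Let  *)
(* K_i be the subproduct over the pairs that contain i. Then K_i and K_j meet *)
(* trivially exactly when i and j are adjacent, so the action of K ><| V on   *)
(* the cosets of K_0 has as Saxl graph the blow-up of the Cayley graph in     *)
(* which each vertex i becomes the independent set K/K_i. Blowing up keeps    *)
(* the diameter, and varying A gives infinitely many degrees.                 *)

Require Import Defs.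
From mathcomp Require Import all_boot all_fingroup all_solvable.
From mathcomp Require Import all_algebra zify.

Set Implicit Arguments.
Unset Strict Implicit.
Unset Printing Implicit Defensive.

Import GroupScope GRing.Theory.

(** For n > 1, a point of block i is fixed by the [twist 0 g] with g supported, among non-edges, on
    pairs containing i ([twist_fix]). A non-edge {i, j} thus yields a nontrivial element fixing
    blocks i and j, whereas no non-edge contains both ends of an edge. So adjacency sees only the
    blocks ([twist_saxl]), and distances are those of the Cayley graph, except that distinct points
    of one block are at distance 2 ([twist_diameter]). Since this exceeds 1, n = 1 is treated apart,
    with regular groups ([rtransl_saxl]). Imprimitivity comes from the fibres of a projection
    ([imprimitive_fibers]), non-isomorphism from distinct degrees. *)

Lemma has_walkP (T : finType) (e : rel T) (x y : T) (d : nat) :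
  reflect (exists p : seq T, [/\ path e x p, last x p = y & size p = d])
          (has_walk e x y d).
Proof.
apply: (iffP existsP) => [[p /andP[ep /eqP lp]]|[p [ep lp sp]]].
  by exists p; rewrite size_tuple.
have sp' : size p == d by apply/eqP.
by exists (Tuple sp'); rewrite /= ep lp eqxx.
Qed.

Lemma graph_dist_le (T : finType) (e : rel T) (x y : T) (d : nat) :
  has_walk e x y d -> graph_dist e x y <= d.
Proof.
move=> w; rewrite /graph_dist; have [ltdT|leTd] := ltnP d #|T|; last first.
  by apply: leq_trans (find_size _ _) _; rewrite size_iota.
rewrite leqNgt; apply/negP => /(before_find 0).
by rewrite nth_iota // add0n w.
Qed.

(** The search in [graph_dist] stops at [#|T|], so [n <= #|T|] ensures that it scans every length
    below n. *)
Lemma graph_dist_ge (T : finType) (e : rel T) (x y : T) (n : nat) :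
  n <= #|T| -> (forall d, d < n -> ~~ has_walk e x y d) ->
  n <= graph_dist e x y.
Proof.
move=> nT nw; rewrite leqNgt; apply/negP => ltn; rewrite /graph_dist in ltn.
have lt' := leq_trans ltn nT.
have hs : has (has_walk e x y) (iota 0 #|T|) by rewrite has_find size_iota.
by have := nth_find 0 hs; rewrite nth_iota // add0n; apply/negP/nw.
Qed.

Lemma connected_diameter (T : finType) (e : rel T) (n : nat) (x0 y0 : T) :
  (forall x y, exists2 d, d <= n & has_walk e x y d) ->
  n <= #|T| -> (forall d, d < n -> ~~ has_walk e x0 y0 d) ->
  graph_connected e /\ graph_diameter e = n.
Proof.
move=> wT nT nw; split.
  apply/forallP=> x; apply/forallP=> y; have [d _ /has_walkP[p [ep lp _]]] := wT x y.
  by apply/connectP; exists p.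
apply/eqP; rewrite eqn_leq; apply/andP; split.
  apply/bigmax_leqP=> x _; apply/bigmax_leqP=> y _.
  by have [d dn /graph_dist_le w] := wT x y; apply: leq_trans w dn.
apply: leq_trans (graph_dist_ge nT nw) _.
apply: leq_trans (leq_bigmax y0) _.
exact: (leq_bigmax (F := fun x => \max_y graph_dist e x y) x0).
Qed.

(** * Imprimitivity *)

(** G permutes the fibres of [phi]. The first pair of points gives two blocks, the second a block
    with two points. *)
Lemma imprimitive_fibers (T U : finType) (G : {group {perm T}}) (phi : T -> U)
    (x1 y1 x2 y2 : T) :
  transitive_group G ->
  (forall g, g \in G -> forall x y, (phi (g x) == phi (g y)) = (phi x == phi y)) ->
  phi x1 != phi y1 -> x2 != y2 -> phi x2 = phi y2 ->
  imprimitive_group G.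
Proof.
move=> trG phiG n1 n2 e2; rewrite /imprimitive_group trG /= /primitive.
rewrite negb_and negbK; apply/orP; right; apply/existsP.
pose B x := [set y in [set: T] | phi x == phi y].
have BE x y : (y \in B x) = (phi x == phi y) by rewrite !inE.
exists (preim_partition phi [set: T]).
have QE : preim_partition phi [set: T] = [set B x | x in [set: T]] by [].
rewrite /imprimitivity_system preim_partitionP /= QE; apply/and3P; split.
- apply/subsetP=> g Gg; rewrite !inE /=; apply/subsetP=> _ /imsetP[x _ ->].
  rewrite inE; apply/imsetP; exists (g x) => //.
  apply/setP=> y; rewrite BE -{2}(permKV g y) phiG // -BE /= /setact.
  apply/idP/idP => [/imsetP[z Bz ->]|By]; first by rewrite permK.
  by apply/imsetP; exists (g^-1 y); rewrite //= /aperm permKV.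
- apply/card_gt1P; exists (B x1), (B y1); split; rewrite ?imset_f ?inE //.
  apply/eqP=> /setP/(_ y1); rewrite !BE eqxx => h.
  by rewrite h in n1.
- rewrite ltn_neqAle leq_imset_card andbT; apply/imset_injP => injB.
  case/eqP: n2; apply: injB; rewrite ?inE //.
  by apply/setP=> z; rewrite !BE e2.
Qed.

Lemma perm_isomorphic_card (T U : finType) (G : {group {perm T}})
    (H : {group {perm U}}) : perm_isomorphic G H -> #|T| = #|U|.
Proof. by case=> f [phi [/bij_eq_card ->]]. Qed.

Lemma zmod_neq0 (V : finZmodType) : 1 < #|V| -> exists v : V, v != 0%R.
Proof.
by case/card_gt1P=> [u [v [_ _ uv]]]; exists (u - v)%R; rewrite subr_eq0.
Qed.

(** * Regular groups: diameter 1 *)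

Section RightRegular.

Variable gT : finGroupType.

Definition rtransl (a : gT) : {perm gT} := perm (mulIg a).

Lemma rtransl_group_set : group_set [set rtransl a | a in [set: gT]].
Proof.
apply/group_setP; split.
  by apply/imsetP; exists 1 => //; apply/permP=> x; rewrite perm1 permE mulg1.
move=> _ _ /imsetP[a _ ->] /imsetP[b _ ->]; apply/imsetP; exists (a * b) => //.
by apply/permP=> x; rewrite permM !permE mulgA.
Qed.

Canonical rtransl_group := Group rtransl_group_set.

Lemma rtranslP p : reflect (exists a, p = rtransl a) (p \in rtransl_group).
Proof. by apply: (iffP imsetP) => [[a _ ->]|[a ->]]; exists a. Qed.

Lemma rtransl_transitive : transitive_group rtransl_group.
Proof.
apply/imsetP; exists 1; first by [].
apply/setP=> x; rewrite inE; apply/esym/imsetP.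
by exists (rtransl x); rewrite ?imset_f //= /aperm permE mul1g.
Qed.

Lemma rtransl_saxl : saxl_graph rtransl_group =2 [rel x y | x != y].
Proof.
move=> x y /=; apply/andb_idr=> _; apply/eqP/trivgP/subsetP=> g.
case/setIP=> /rtranslP[a ->] /astabP/(_ x); rewrite !inE eqxx => /(_ isT).
rewrite /= /aperm permE => /eqP; rewrite -{2}[x]mulg1 (inj_eq (mulgI x)) => /eqP->.
by apply/eqP/permP=> z; rewrite perm1 permE mulg1.
Qed.

End RightRegular.

Lemma complete_graph_diameter (T : finType) (e : rel T) (x0 y0 : T) :
  e =2 [rel x y | x != y] -> x0 != y0 ->
  graph_connected e /\ graph_diameter e = 1%N.
Proof.
move=> eE n0; apply: (connected_diameter (x0 := x0) (y0 := y0)).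
- move=> x y; have [->|nxy] := eqVneq x y.
    by exists 0 => //; apply/has_walkP; exists [::].
  by exists 1%N => //; apply/has_walkP; exists [:: y]; rewrite /= eE /= nxy.
- by apply/card_gt0P; exists x0.
- case=> // _; apply/negP => /has_walkP[p [_ lp /size0nil p0]].
  by rewrite -lp p0 eqxx in n0.
Qed.

(** * The blow-up group and its Saxl graph *)

(* [twist_group] is the semidirect product of the functions g on pairs by V,  *)
(* acting on the cosets of K_0. The pair (x, d) stands for the two vertices   *)
(* {x, x + d}; in block i the pairs are recentred at i, so [avoid] selects    *)
(* the non-edges missing the base vertex, and {ffun J -> A} is K/K_i for      *)
(* every i. Values of g on edges act trivially.                               *)
Section Twist.

Variables (V A : finZmodType) (S : {set V}).

Definition avoid : pred (V * V) :=
  fun z => [&& z.2 \notin S, z.1 != 0%R & (z.1 + z.2)%R != 0%R].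

Local Notation J := {z : V * V | avoid z}.
Local Notation T := (V * {ffun J -> A})%type.

Definition twistf (a : V) (g : {ffun V * V -> A}) (x : T) : T :=
  ((x.1 + a)%R, [ffun z => (x.2 z + g (((val z).1 + x.1), (val z).2))%R]).

Lemma twistf_inj a g : injective (twistf a g).
Proof.
move=> [i f] [j h] [/addIr eij /ffunP efh]; rewrite eij; congr pair.
by apply/ffunP=> z; have := efh z; rewrite !ffunE /= eij => /addIr.
Qed.

Definition twist a g : {perm T} := perm (@twistf_inj a g).

Definition twist_set : {set {perm T}} :=
  [set twist u.1 u.2 | u in [set: V * {ffun V * V -> A}]].

Lemma mem_twist a g : twist a g \in twist_set.
Proof. exact: (imset_f (fun u => twist u.1 u.2) (in_setT (a, g))). Qed.

Lemma twist_setP p : reflect (exists a g, p = twist a g) (p \in twist_set).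
Proof.
apply: (iffP imsetP) => [[[a g] _ ->]|[a [g ->]]]; first by exists a, g.
by exists (a, g).
Qed.

Lemma twist0 (g : {ffun V * V -> A}) :
  (forall z, z.2 \notin S -> g z = 0%R) -> twist 0%R g = 1.
Proof.
move=> g0; apply/permP=> -[i f]; rewrite perm1 permE /twistf addr0.
congr pair; apply/ffunP=> z; rewrite ffunE g0 ?addr0 //.
by have /and3P[] := valP z.
Qed.

Lemma twist_group_set : group_set twist_set.
Proof.
apply/group_setP; split.
  by apply/twist_setP; exists 0%R, [ffun=> 0%R]; rewrite twist0 // => z; rewrite ffunE.
move=> _ _ /twist_setP[a [g ->]] /twist_setP[b [h ->]]; apply/twist_setP.
(* h acts after the block has moved by a, hence the shift in its argument. *)
exists (a + b)%R, [ffun z => (g z + h (z.1 + a, z.2))%R].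
apply/permP=> -[i f]; rewrite permM !permE /twistf /= addrA.
by congr pair; apply/ffunP=> z; rewrite !ffunE /= addrA addrA.
Qed.

Canonical twist_group := Group twist_group_set.

Lemma twist_transitive : transitive_group twist_group.
Proof.
apply/imsetP; exists (0%R, [ffun=> 0%R]); first by [].
apply/setP=> -[i f]; rewrite inE; apply/esym/imsetP.
(* In block 0 pairs are not recentred, so g is f extended by 0. *)
exists (twist i [ffun z => if insub z is Some w then f w else 0%R]).
  exact: mem_twist.
rewrite /= /aperm permE /twistf /= add0r; congr pair.
apply/ffunP=> z; rewrite !ffunE add0r addr0 -surjective_pairing.
by rewrite valK.
Qed.

Lemma twist_fix g i f :
  (twist 0%R g (i, f) == (i, f)) =
  [forall z, [&& z.2 \notin S, z.1 != i & (z.1 + z.2)%R != i] ==> (g z == 0%R)].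
Proof.
rewrite permE /twistf /= addr0; apply/eqP/forallP => [[/ffunP gf] [x d]|g0].
  apply/implyP=> /= /and3P[dS xi xdi].
  have xdJ : avoid ((x - i)%R, d).
    by rewrite /avoid /= dS subr_eq0 xi addrAC subr_eq0.
  have := gf (Sub (_, d) xdJ); rewrite ffunE /= subrK => /eqP.
  by rewrite -{2}[f _]addr0 (inj_eq (addrI _)).
congr pair; apply/ffunP=> z; rewrite ffunE.
have /and3P[z1 z2 z3] := valP z.
have := g0 ((val z).1 + i, (val z).2)%R; rewrite /= z1 /= -subr_eq0 addrK z2.
by rewrite -subr_eq0 addrAC addrK z3 /= => /eqP->; rewrite addr0.
Qed.

Hypotheses (S0 : 0%R \notin S) (SN : forall v, (- v)%R \in S = (v \in S)).
Hypotheses (V3 : 2 < #|V|) (A2 : 1 < #|A|).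

Lemma twist_saxl (x y : T) :
  saxl_graph twist_group x y = ((y.1 - x.1)%R \in S).
Proof.
case: x y => [i f] [j h] /=; apply/andP/idP => [[_ /eqP bs]|jiS].
  apply: contraT => jiS.
  (* A third block, where the common stabiliser will act nontrivially. *)
  have [k kij] : exists k, k \notin [set i; j].
    apply/existsP; rewrite -negb_forall; apply/negP=> /forallP ij.
    have : #|V| <= #|[set i; j]| by apply/subset_leq_card/subsetP=> z _; apply: ij.
    by rewrite cards2; move: V3; case: (i != j); lia.
  have [a a0] := zmod_neq0 A2.
  (* The support of g is the non-edge {i, j}, which contributes to neither block i nor block j. *)
  pose g := [ffun z => if z == (i, (j - i)%R) then a else 0%R].
  have : twist 0%R g \in 'C_twist_group([set (i, f); (j, h)] | 'P).
    rewrite inE mem_twist; apply/astabP=> z; rewrite !inE /= /aperm.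
    case/orP=> /eqP->; apply/eqP; rewrite twist_fix; apply/forallP=> -[u d];
      apply/implyP=> /= /and3P[_ ui udi]; rewrite ffunE; case: ((u, d) =P _) => // -[eu ed].
      by rewrite eu eqxx in ui.
    by rewrite eu ed addrC subrK eqxx in udi.
  rewrite bs inE => /eqP/permP/(_ (k, [ffun=> 0%R])); rewrite perm1 => /eqP.
  rewrite twist_fix => /forallP/(_ (i, j - i)%R); rewrite ffunE eqxx (negPf a0) /=.
  by move: kij; rewrite !inE negb_or ![k == _]eq_sym jiS addrC subrK => /andP[-> ->].
have nij : i != j by apply: contraNneq S0 => e; rewrite e subrr in jiS.
split; first by rewrite xpair_eqE negb_and nij.
apply/eqP/trivgP/subsetP=> p /setIP[/twist_setP[a [g ->]] /astabP fx].
have /= := fx (i, f); rewrite /aperm !inE eqxx => /(_ isT) fi.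
have /= := fx (j, h); rewrite /aperm !inE eqxx orbT => /(_ isT) fj.
have a0 : a = 0%R.
  by move: fi; rewrite permE => -[/eqP]; rewrite -{2}[i]addr0 (inj_eq (addrI i)) => /eqP.
rewrite a0 in fi fj *; move/eqP: fi; move/eqP: fj; rewrite !twist_fix.
move=> /forallP gj /forallP gi; apply/eqP; apply: twist0 => -[x d] /= dS.
(* A pair missing i or j is killed by [gi] or [gj]; one containing both has d = j - i or d = i - j,
   hence d in S. *)
have := gi (x, d); have := gj (x, d); rewrite /= dS /=.
have [->|xi] /= := eqVneq x i; last first.
  have [xdi|xdi] /= := eqVneq (x + d)%R i; last by move=> _ /eqP.
  have [xj|xj] /= := eqVneq x j.
    by move: jiS; rewrite -xj -xdi opprD addrA subrr add0r SN (negPf dS).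
  by rewrite xdi nij => /eqP.
rewrite nij /=; have [ed|_ /eqP//] := eqVneq (i + d)%R j.
by move: jiS; rewrite -ed addrAC subrr add0r (negPf dS).
Qed.

(** The loop {v, v} is a non-edge missing 0, so block sizes grow with A. *)
Lemma avoid_subtype_gt0 (v : V) : v != 0%R -> 0 < #|{: J}|.
Proof.
move=> v0; have Jv : avoid (v, 0%R) by rewrite /avoid /= S0 addr0 v0.
by apply/card_gt0P; exists (Sub _ Jv).
Qed.

Lemma twist_imprimitive : imprimitive_group twist_group.
Proof.
have [v v0] := zmod_neq0 (ltnW V3).
have [a a0] := zmod_neq0 A2.
apply: (@imprimitive_fibers _ _ _ fst (0%R, [ffun=> 0%R]) (v, [ffun=> 0%R])
  (0%R, [ffun=> 0%R]) (0%R, [ffun=> a])) => //=.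
- exact: twist_transitive.
- by move=> _ /twist_setP[b [g ->]] x y; rewrite !permE /= (inj_eq (addIr b)).
- by rewrite eq_sym.
- have /card_gt0P[z _] := avoid_subtype_gt0 v0.
  by rewrite xpair_eqE eqxx /=; apply: contraNneq a0 => /ffunP/(_ z); rewrite !ffunE => <-.
Qed.

(** * Walks in the blow-up *)

Definition cayley : rel V := [rel u v | (v - u)%R \in S].

Lemma twist_walk_proj (x y : T) d :
  has_walk (saxl_graph twist_group) x y d -> has_walk cayley x.1 y.1 d.
Proof.
case/has_walkP=> p [ep <- <-]; apply/has_walkP; exists (map fst p).
rewrite last_map size_map; split=> //.
by rewrite path_map; apply: sub_path ep => u v; rewrite twist_saxl.
Qed.

(** Every vertex after x can carry the second coordinate of y; a walk of length 0 could not change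
    it. *)
Lemma twist_walk_lift (x y : T) d :
  0 < d -> has_walk cayley x.1 y.1 d -> has_walk (saxl_graph twist_group) x y d.
Proof.
move=> d0 /has_walkP[p [ep lp sp]]; apply/has_walkP.
exists [seq (v, y.2) | v <- p]; rewrite size_map; split=> //.
  rewrite (eq_path (e' := fun u w => cayley u.1 w.1)); last exact: twist_saxl.
  have fstp : map fst [seq (v, y.2) | v <- p] = p by rewrite -map_comp map_id_in.
  by move: ep; rewrite -{1}fstp path_map.
case/lastP: p d0 {ep} lp sp => [|p u] d0; first by move=> _ d0'; rewrite -d0' in d0.
by rewrite map_rcons !last_rcons => -> _; case: (y).
Qed.

Lemma twist_diameter n (u0 v0 : V) :
  1 < n -> (forall u v, exists2 d, d <= n & has_walk cayley u v d) ->
  n <= #|V| -> (forall d, d < n -> ~~ has_walk cayley u0 v0 d) ->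
  graph_connected (saxl_graph twist_group) /\
  graph_diameter (saxl_graph twist_group) = n.
Proof.
move=> n1 wV nV nw.
apply: (@connected_diameter _ _ _ (u0, [ffun=> 0%R]) (v0, [ffun=> 0%R])).
- move=> x y; have [d dn w] := wV x.1 y.1.
  have [d0|d0] := posnP d; last by exists d => //; apply: twist_walk_lift.
  exists 2 => //; apply: twist_walk_lift => //.
  move: w; rewrite d0 => /has_walkP[p [_ <- /size0nil->]] /= {p}.
  (* Connectedness provides a generator, hence a closed walk of length two. *)
  have [s sS] : exists s, s \in S.
    have [v vx] : exists v, v != x.1.
      have /card_gt1P[a [b [_ _ ab]]] := ltnW V3.
      by have [ax|] := eqVneq a x.1; [exists b; rewrite -ax eq_sym | exists a].
    have [d' _ /has_walkP[p [ep lp _]]] := wV x.1 v.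
    case: p ep lp => [|w p] /= ep lp.
      by rewrite -lp eqxx in vx.
    by case/andP: ep => wS _; exists (w - x.1)%R.
  apply/has_walkP; exists [:: (x.1 + s)%R; x.1]; split=> //=.
  by rewrite /cayley /= addrAC subrr add0r sS opprD addrA subrr add0r SN sS.
- by apply: leq_trans nV _; rewrite card_prod leq_pmulr // card_ffun expn_gt0 ltnW.
- by move=> d dn; apply: contra (nw d dn) => /twist_walk_proj.
Qed.

End Twist.

(** * Distances in the cycle of length 2m + 4 *)

Lemma cayley_walk_muln (V : finZmodType) (S : {set V}) (u s : V) d :
  s \in S -> has_walk (cayley S) u (u + s *+ d)%R d.
Proof.
move=> sS; elim: d => [|d /has_walkP[p [ep lp sp]]]; apply/has_walkP.
  by exists [::]; rewrite mulr0n addr0.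
exists (rcons p (u + s *+ d.+1)%R); rewrite rcons_path last_rcons size_rcons sp lp ep.
by split=> //; rewrite /cayley /= mulrSr addrA [X in X \in _]addrC addKr.
Qed.

Section Cycle.

Variable m : nat.
Local Notation V := 'I_(m.*2.+4).

Definition cycle_gens : {set V} := [set 1%R; (-1)%R].

Lemma cycle_gensN (v : V) : (- v)%R \in cycle_gens = (v \in cycle_gens).
Proof. by rewrite !inE eqr_opp orbC eqr_oppLR. Qed.

Lemma cycle_gens0 : 0%R \notin cycle_gens.
Proof. by rewrite !inE eq_sym oner_eq0 eq_sym oppr_eq0 oner_eq0. Qed.

(** The forward and backward routes have total length 2m + 4, so one has length at most m + 2. *)
Lemma cycle_walk_le (u v : V) :
  exists2 d, d <= m.+2 & has_walk (cayley cycle_gens) u v d.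
Proof.
have vE : v = (u + 1 *+ val (v - u)%R)%R by rewrite (natr_Zp (v - u)%R) addrC subrK.
have [le|lt] := leqP (val (v - u)%R) m.+2.
  exists (val (v - u)%R) => //; rewrite [X in has_walk _ _ X]vE.
  by apply: cayley_walk_muln; rewrite !inE eqxx.
exists (m.*2.+4 - val (v - u)%R); first by lia.
have vE' : v = (u + (-1) *+ (m.*2.+4 - val (v - u)%R))%R.
  rewrite mulrnBr; last exact: ltnW (ltn_ord _).
  rewrite !mulNrn opprK (_ : 1 *+ m.*2.+4 = 0)%R ?oppr0 ?add0r //.
  by apply: val_inj; rewrite Zp_nat /= modnn.
rewrite [X in has_walk _ _ X]vE'.
by apply: cayley_walk_muln; rewrite !inE eqxx orbT.
Qed.

(** Each step changes the distance to 0 around the cycle by at most 1. *)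
Lemma cycle_path_last (p : seq V) : path (cayley cycle_gens) 0%R p ->
  (last 0%R p <= size p) || (m.*2.+4 - last 0%R p <= size p).
Proof.
elim/last_ind: p => [//|p v IH]; rewrite rcons_path last_rcons size_rcons.
case/andP=> /IH {IH}; set u := last _ _ => IH /=.
have lu := ltn_ord u.
rewrite /cayley /= !inE !subr_eq => /orP[] /eqP->.
  rewrite /= (modn_small (m := 1)) //.
  (* A forward step wraps only from 2m + 3 to 0. *)
  have [lt|ge] := ltnP (1 + u)%N m.*2.+4; first by rewrite modn_small //; lia.
  have -> : (1 + u = m.*2.+4)%N by lia.
  by rewrite modnn.
rewrite /= (modn_small (m := 1)) // (modn_small (m := _ - 1)); last by lia.
(* A backward step wraps only at 0. *)
have [u0|u0] := posnP u; first by rewrite u0 addn0 modn_small; lia.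
have -> : (m.*2.+4 - 1 + u = u.-1 + m.*2.+4)%N by lia.
by rewrite modnDr modn_small; lia.
Qed.

(** The antipode m + 2 of 0 is equally far in both directions. *)
Lemma cycle_walk_ge d : d < m.+2 ->
  ~~ has_walk (cayley cycle_gens) 0%R (inord m.+2) d.
Proof.
move=> dm; apply/negP=> /has_walkP[p [/cycle_path_last ep lp sp]].
by move: ep; rewrite lp sp inordK; lia.
Qed.

End Cycle.

Theorem corollary4p3 (n : nat) (n_gt0 : 0 < n) :
  exists (T : nat -> finType) (G : forall k : nat, {group {perm T k}}),
    (forall k : nat,
       [/\ transitive_group (G k),
           imprimitive_group (G k),
           graph_connected (saxl_graph (G k)) &
           graph_diameter (saxl_graph (G k)) = n])
    /\ (forall i j : nat, perm_isomorphic (G i) (G j) -> i = j).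
Proof.
case: n n_gt0 => [//|[|m]] _.
  (* The factor ['I_2] indexes two blocks of size k + 2. *)
  exists (fun k => ('I_2 * 'I_k.+2)%type), (fun k => rtransl_group ('I_2 * 'I_k.+2)%type).
  split=> [k|i j /perm_isomorphic_card]; last by rewrite !card_prod !card_ord; lia.
  have [conn diam] := @complete_graph_diameter _ (saxl_graph (rtransl_group ('I_2 * 'I_k.+2)%type))
    (ord0, ord0) (ord0, ord_max) (@rtransl_saxl _) isT.
  split=> //; first exact: rtransl_transitive.
  apply: (@imprimitive_fibers _ _ _ fst (ord0, ord0) (ord_max, ord0)
    (ord0, ord0) (ord0, ord_max)) => //; first exact: rtransl_transitive.
  by move=> g /rtranslP[b ->] x y; rewrite !permE /= (inj_eq (mulIg _)).
pose S := cycle_gens m; have S0 := cycle_gens0 m; have SN := @cycle_gensN m.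
have V3 : 2 < #|'I_m.*2.+4| by rewrite card_ord.
exists (fun k => ('I_m.*2.+4 * {ffun {z : 'I_m.*2.+4 * 'I_m.*2.+4 | avoid S z} -> 'I_k.+2})%type).
exists (fun k => twist_group 'I_k.+2 S).
split=> [k|i j /perm_isomorphic_card].
  have A2 : 1 < #|'I_k.+2| by rewrite card_ord.
  have [//||||conn diam] := @twist_diameter _ 'I_k.+2 S S0 SN V3 A2 m.+2 0%R (inord m.+2).
  - exact: cycle_walk_le.
  - by rewrite card_ord; lia.
  - exact: cycle_walk_ge.
  - split=> //; first exact: twist_transitive.
    exact: twist_imprimitive.
(* The degree is (2m + 4)(k + 2)^e with the same e > 0 for all k, so it determines k. *)
rewrite !card_prod !card_ffun => /eqP; rewrite eqn_pmul2l ?card_ord //.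
rewrite eqn_exp2r => [/eqP[]//|].
exact: (avoid_subtype_gt0 S0 (v := 1%R)).
Qed.
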